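(* For all $0\le i\le n$, $|x_i(t+1)-x_i(t)|\rightarrow 0$ as $t\rightarrow\infty$. Moreover, $X(t)$ converges towards a fixed configuration as $t\rightarrow\infty$, i.e. there are real numbers $p_0,\dots,p_n$ with $x_i(t)\rightarrow p_i$ as $t\rightarrow\infty$ for all $0\le i\le n$.
   Context: $X=\{x_0,x_1,\dots,x_n\}$ is a finite set of robots on the real line; $x(t)$ is the position of robot $x$ at the discrete time $t=0,1,2,\dots$, and $X(t)=\{x_0(t),\dots,x_n(t)\}$. Exactly two robots, $x_0$ and $x_n$, are faulty and never move: $x_0(t)=0$ and $x_n(t)$ is a fixed positive number for all $t$. $V>0$ is the visibility radius. $N(x(t))$ is the set of robots $y$ with $|x(t)-y(t)|\le V$ (so $x$ itself belongs to it); $l(x(t))$ and $r(x(t))$ denote the leftmost and the rightmost robot in $N(x(t))$ (and also their positions). All robots act synchronously: every non-faulty robot $x$ satisfies $x(t+1)=\frac{l(x(t))+r(x(t))}{2}$ for all $t\ge 0$. Robots need not occupy distinct positions; non-faulty robots occupying the same position behave identically. *)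

(* Defs.v *)
From HB Require Import structures.
From mathcomp Require Import all_boot all_order all_algebra.
From mathcomp Require Import all_classical all_reals all_analysis.
Set Implicit Arguments.
Unset Strict Implicit.
Unset Printing Implicit Defensive.
Import Order.TTheory GRing.Theory Num.Theory.
Import numFieldNormedType.Exports.
Local Open Scope ring_scope.

(* A configuration of the robots x_0, ..., x_n is a map p : 'I_n.+1 -> R;
   it need not be injective, nor monotone in the index. *)

Definition neighborhood (R : realType) (n : nat) (V : R) (p : 'I_n.+1 -> R)
  (i : 'I_n.+1) : {set 'I_n.+1} := [set j | `|p i - p j| <= V].

(* When several visible robots share the extremal position, arg min and
   arg max choose one of them; only its position p _ is used afterwards. The
   default i is visible from itself as soon as 0 <= V. *)
Definition leftmost (R : realType) (n : nat) (V : R) (p : 'I_n.+1 -> R)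
  (i : 'I_n.+1) : 'I_n.+1 := [arg min_(j < i in neighborhood V p i) p j]%O.

Definition rightmost (R : realType) (n : nat) (V : R) (p : 'I_n.+1 -> R)
  (i : 'I_n.+1) : 'I_n.+1 := [arg max_(j > i in neighborhood V p i) p j]%O.

(* Main.v *)
(** Visible pairs of robots stay visible, so the visibility graph is eventually
constant, and from then on the robots follow a fixed map which preserves
inequalities [p <= p' + c] for every constant [c]; hence it is nonexpansive for
the sup distance, and the largest rightward move is nonincreasing in time. Were
its limit [delta] positive, a robot moving right by about [delta] would force,
one step earlier, the leftmost robot that it sees to move by about [delta] and
to lie about [delta] to its left; going back long enough contradicts
boundedness. By reflection the leftward moves vanish as well, so every cluster
point of the trajectory is a fixed point of the map, and by nonexpansiveness the
trajectory converges to it. *)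

Require Import Defs.
From HB Require Import structures.
From mathcomp Require Import all_boot all_order all_algebra.
From mathcomp Require Import all_classical all_reals all_analysis.
From mathcomp Require Import lra.
Set Implicit Arguments.
Unset Strict Implicit.
Unset Printing Implicit Defensive.
Import Order.TTheory GRing.Theory Num.Theory.
Import numFieldNormedType.Exports.
Local Open Scope classical_set_scope.
Local Open Scope ring_scope.

(** * Midrange steps for a fixed neighborhood map *)

(* The points of [F] stay put, the others jump to the midrange of their
   neighborhood. A relation rather than a function, so that it is manifestly
   invariant under reflection. *)
Definition midrange_step (R : realType) (T : finType) (N : T -> {set T})
  (F : {set T}) (p q : T -> R) : Prop :=
  forall i, if i \in F then q i = p i else
    exists a b, [/\ a \in N i, b \in N i,
      forall j, j \in N i -> p a <= p j <= p b & q i = (p a + p b) / 2].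

Lemma midrange_step_exists (R : realType) (T : finType) (N : T -> {set T})
  (F : {set T}) (p : T -> R) :
  (forall i, i \in N i) -> exists q, midrange_step N F p q.
Proof.
move=> Nii; suff /choice[q qP] : forall i, exists y : R,
    if i \in F then y = p i else
    exists a b, [/\ a \in N i, b \in N i,
      forall j, j \in N i -> p a <= p j <= p b & y = (p a + p b) / 2].
  by exists q.
move=> i; case: (i \in F); first by exists (p i).
case: (@arg_minP _ _ _ i (mem (N i)) p (Nii i)) => a aN amin.
case: (@arg_maxP _ _ _ i (mem (N i)) p (Nii i)) => b bN bmax.
exists ((p a + p b) / 2), a, b; split => // j jN.
by rewrite (amin j jN); exact: bmax.
Qed.

Lemma midrange_stepN (R : realType) (T : finType) (N : T -> {set T})
  (F : {set T}) (p q : T -> R) :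
  midrange_step N F p q ->
  midrange_step N F (fun i => - p i) (fun i => - q i).
Proof.
move=> pq i; move: (pq i); case: ifP => _ => [->//|[a [b [aN bN ab ->]]]].
exists b, a; split => // [j /ab/andP[paj pjb]|]; last by lra.
by rewrite !lerN2 paj pjb.
Qed.

(** Both steps use the same [N i], so [p a <= p a' <= p' a' + c] and
    [p b <= p' b + c <= p' b' + c]. *)
Lemma midrange_step_le (R : realType) (T : finType) (N : T -> {set T})
  (F : {set T}) (p q p' q' : T -> R) (c : R) :
  midrange_step N F p q -> midrange_step N F p' q' ->
  (forall i, p i <= p' i + c) -> forall i, q i <= q' i + c.
Proof.
move=> pq pq' le_pp' i; move: (pq i) (pq' i); case: ifP => _ => [-> ->//|].
move=> [a [b [aN bN ab ->]]] [a' [b' [a'N b'N ab' ->]]].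
have /andP[+ _] := ab _ a'N; have /andP[_] := ab' _ bN.
have := le_pp' a'; have := le_pp' b; lra.
Qed.

Lemma midrange_step_dist (R : realType) (T : finType) (N : T -> {set T})
  (F : {set T}) (p q p' q' : T -> R) (c : R) :
  midrange_step N F p q -> midrange_step N F p' q' ->
  (forall i, `|p i - p' i| <= c) -> forall i, `|q i - q' i| <= c.
Proof.
move=> pq pq' le_pp' i; rewrite ler_distl; apply/andP; split.
  rewrite lerBlDr; apply: (midrange_step_le pq' pq) => j.
  by have := le_pp' j; rewrite ler_distl => /andP[]; lra.
apply: (midrange_step_le pq pq') => j.
by have := le_pp' j; rewrite ler_distl => /andP[]; lra.
Qed.

Lemma midrange_step_bounded (R : realType) (T : finType) (N : T -> {set T})
  (F : {set T}) (p q : T -> R) (B : R) :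
  midrange_step N F p q -> (forall i, `|p i| <= B) -> forall i, `|q i| <= B.
Proof.
move=> pq pB i; move: (pq i); case: ifP => _ => [->//|].
move=> [a [b [_ _ _ ->]]]; have := pB a; have := pB b.
by rewrite !ler_norml => /andP[? ?] /andP[? ?]; apply/andP; split; lra.
Qed.

(** * Vanishing of the moves *)

(** As [q b' <= p b + m], the right end contributes at most [m / 2] to the move of [i], which forces
    [q a' > p a + (m - eta *+ 2)] at the left end. Both conclusions follow, since [q a'] is at most
    [q a] and [q i]. *)
Lemma midrange_step_back (R : realType) (T : finType) (N : T -> {set T})
  (F : {set T}) (p q r : T -> R) (m eta : R) (i : T) :
  (forall i, i \in N i) ->
  midrange_step N F p q -> midrange_step N F q r ->
  (forall j, q j <= p j + m) -> eta <= m -> m - eta < r i - q i ->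
  exists a, m - eta *+ 2 < q a - p a /\ p a <= q i - (m - eta *+ 2).
Proof.
move=> Nii pq qr le_m le_eta.
move: (pq i) (qr i); case: ifP => _ => [_ ->|]; first by lra.
move=> [a [b [aN bN ab qi]]] [a' [b' [a'N b'N ab' ri]]] lt_i.
exists a.
have /andP[ qa'a _] := ab' _ aN; have /andP[qa'i _] := ab' _ (Nii i).
have /andP[_ pb'b] := ab _ b'N; have := le_m b'; rewrite mulr2n; split; lra.
Qed.

(** Each step back in time doubles the slack [eta]. The bound on [eta *+ 2 ^ k] keeps every one of
    the [k] displacements to the left at least [c]. *)
Lemma midrange_drift (R : realType) (T : finType) (N : T -> {set T})
  (F : {set T}) (x : nat -> T -> R) (m c : R) (k : nat) :
  (forall i, i \in N i) -> 0 <= c ->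
  (forall t, midrange_step N F (x t) (x t.+1)) ->
  (forall t j, x t.+1 j <= x t j + m) ->
  forall (eta : R) (i : T), 0 <= eta -> eta *+ 2 ^ k <= m - c ->
  m - eta < x k.+1 i - x k i -> exists j, x 0%N j <= x k i - c *+ k.
Proof.
move=> Nii c_ge0 xS le_m; elim: k => [|k IHk] eta i eta_ge0 le_eta lt_i.
  by exists i; rewrite mulr0n subr0.
have eta2 : eta *+ 2 ^ k.+1 = eta *+ 2 *+ 2 ^ k by rewrite -mulrnA -expnS.
have le_eta2 : eta *+ 2 <= eta *+ 2 ^ k.+1.
  by rewrite ler_wpMn2l// expnS leq_pmulr// expn_gt0.
have [|a [lt_a le_a]] := midrange_step_back Nii (xS k) (xS k.+1) (le_m k) _ lt_i.
  by move: le_eta2; rewrite mulr2n; lra.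
have [||j le_j] := IHk (eta *+ 2) a _ _ lt_a.
- by rewrite mulrn_wge0.
- by rewrite -eta2.
by exists j; rewrite mulrS; lra.
Qed.

Lemma midrange_move_le (R : realType) (T : finType) (N : T -> {set T})
  (F : {set T}) (x : nat -> T -> R) (B e : R) :
  (forall i, i \in N i) ->
  (forall t, midrange_step N F (x t) (x t.+1)) ->
  (forall t i, `|x t i| <= B) -> 0 < e ->
  \forall t \near \oo, forall i, x t.+1 i <= x t i + e.
Proof.
move=> Nii xS xB e_gt0.
(* A bound on the moves persists: [x s.+2] and [x s.+1] are the images of [x s.+1] and [x s] under
   the same step. *)
have le_x c t : (forall i, x t.+1 i <= x t i + c) ->
    forall s, (t <= s)%N -> forall i, x s.+1 i <= x s i + c.
  move=> le_t; elim=> [|s IHs]; first by rewrite leqn0 => /eqP <-.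
  rewrite leq_eqVlt => /predU1P[<-//|/IHs].
  exact: (midrange_step_le (xS s.+1) (xS s)).
(* Without a robot, the set [S] below would have no lower bound. *)
have [[i0 _]|T0] := pselect (exists i : T, true); last first.
  by apply: nearW => t i; case: T0; exists i.
have boundsB t i : - B <= x t i <= B by rewrite -ler_norml.
pose S := [set c : R | exists t, forall i, x t.+1 i <= x t i + c].
have S2B : S (B + B).
  by exists 0%N => i; have /andP[] := boundsB 0%N i; have /andP[] := boundsB 1%N i; lra.
have lbS : has_lbound S.
  exists (- (B + B)) => c [t /(_ i0)].
  by have /andP[] := boundsB t i0; have /andP[] := boundsB t.+1 i0; lra.
have infS : has_inf S by split=> //; exists (B + B).
suff : inf S <= 0.
  move=> le0; have [c [t le_t] lt_c] := inf_adherent e_gt0 infS.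
  exists t => // s /= ts i; have := le_x c t le_t s ts i; lra.
rewrite leNgt; apply/negP => delta_gt0; set delta := inf S in delta_gt0.
have B_ge0 : 0 <= B by apply: le_trans (xB 0%N i0).
(* [K] displacements of [delta / 2] exceed the length of [[- B, B]]. *)
pose K := Num.bound ((B + B) / (delta / 2)).
have ltK : B + B < delta / 2 *+ K.
  rewrite -mulr_natr mulrC -ltr_pdivrMr; last by lra.
  by apply: archi_boundP; rewrite divr_ge0//; lra.
pose P : R := (2 ^ K)%:R.
have P_ge1 : 1 <= P by rewrite ler1n expn_gt0.
(* With [m = delta + eps] and [c = delta / 2], the initial slack [eps *+ 2] grows in [K] doublings
   to [delta / 2], which is below [m - c]. *)
pose eps := delta / 4 / P.
have epsP : eps * P = delta / 4 by rewrite divfK//; lra.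
have eps_gt0 : 0 < eps by rewrite /eps !divr_gt0//; lra.
have [c [t0 le_t0] lt_c] := inf_adherent eps_gt0 infS.
have /existsNP[i /negP] : ~ forall i, x (K + t0).+1 i <= x (K + t0)%N i + (delta - eps).
  move=> le_K; have /(ge_inf lbS) : S (delta - eps) by exists (K + t0)%N.
  by rewrite -/delta; lra.
rewrite -ltNge => lt_i.
have [||||||j] := @midrange_drift R T N F (fun t => x (t + t0)%N) (delta + eps)
    (delta / 2) K Nii _ _ _ (eps *+ 2) i.
- by lra.
- by move=> t; exact: xS.
- move=> t j; have := le_x c t0 le_t0 (t + t0)%N (leq_addl _ _) j.
  by rewrite addSn; move: lt_c; rewrite -/delta; lra.
- by rewrite mulrn_wge0// ltW.
- by rewrite mulrnAC -[eps *+ 2 ^ K]mulr_natr -/P epsP; lra.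
- by rewrite addSn mulr2n; lra.
have /andP[+ _] := boundsB (0 + t0)%N j; have /andP[_] := boundsB (K + t0)%N i.
lra.
Qed.

Lemma midrange_move_cvg0 (R : realType) (T : finType) (N : T -> {set T})
  (F : {set T}) (x : nat -> T -> R) (B e : R) :
  (forall i, i \in N i) ->
  (forall t, midrange_step N F (x t) (x t.+1)) ->
  (forall t i, `|x t i| <= B) -> 0 < e ->
  \forall t \near \oo, forall i, `|x t.+1 i - x t i| <= e.
Proof.
move=> Nii xS xB e_gt0.
have right_le := midrange_move_le Nii xS xB e_gt0.
have left_le : \forall t \near \oo, forall i, - x t.+1 i <= - x t i + e.
  apply: (@midrange_move_le R T N F (fun t i => - x t i) B) => // [t|t i].
    exact: midrange_stepN.
  by rewrite normrN.
near=> t => i; rewrite ler_distl; apply/andP; split.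
  have : - x t.+1 i <= - x t i + e by move: i; near: t.
  by lra.
by move: i; near: t.
Unshelve. all: by end_near. Qed.

(** * Convergence for a fixed neighborhood map *)

(** Tychonoff gives a cluster point in the product topology; as [T] is finite, sup-distance balls
    are neighborhoods there. The set [A] allows the close time to be taken among those with any
    eventual property. *)
Lemma bounded_cluster (R : realType) (T : finType) (x : nat -> T -> R) (B : R) :
  (forall t i, `|x t i| <= B) ->
  exists p : T -> R, forall (e : R) (A : set nat), 0 < e -> (\oo : set_system nat) A ->
    exists2 t, A t & forall i, `|p i - x t i| <= e.
Proof.
move=> xB.
have [|p [_ clp]] := @tychonoff T (fun=> R) (fun=> [set` `[- B, B]])
    (fun=> @segment_compact R (- B) B) (x @ \oo) _.
  by exists 0%N => // t _ i /=; rewrite in_itv /= -ler_norml.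
exists p => e A e_gt0 A_oo.
have [||f [[t At <-] pf]] := clp (x @` A)
    [set f | forall i, `|p i - f i| <= e].
- by apply: filterS A_oo => t At; exists t.
- have FF : Filter (nbhs (p : prod_topology (fun=> R : topologicalType))) by exact: nbhs_filter.
  apply: (@filter_forall _ _ _ _ FF) => i.
  apply: (@proj_continuous T (fun=> R) i p [set y | `|p i - y| <= e]).
  exact: (@cvgr_dist_le _ _ _ _ _ id (p i) cvg_id e e_gt0).
by exists t.
Qed.

Lemma midrange_cvg (R : realType) (T : finType) (N : T -> {set T})
  (F : {set T}) (x : nat -> T -> R) (B : R) :
  (forall i, i \in N i) ->
  (forall t, midrange_step N F (x t) (x t.+1)) ->
  (forall t i, `|x t i| <= B) ->
  exists p : T -> R, forall i, x t i @[t --> \oo] --> p i.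
Proof.
move=> Nii xS xB; have [p clp] := bounded_cluster xB.
have [q pq] := @midrange_step_exists R T N F p Nii.
have qp : q = p.
  apply/funext => i; apply/eqP; rewrite -subr_eq0 -normr_le0.
  apply/ler_addgt0Pr => e e_gt0; rewrite add0r.
  (* The three thirds bound the distances from [q] to [x t.+1], from [x t.+1] to [x t], and from
     [x t] to [p]. *)
  have e3_gt0 : 0 < e / 3 by lra.
  have [t le_t px] := clp _ _ e3_gt0 (midrange_move_cvg0 Nii xS xB e3_gt0).
  have := midrange_step_dist pq (xS t) px i; have := le_t i; have := px i.
  rewrite !ler_distl => /andP[? ?] /andP[? ?] /andP[? ?].
  by apply/andP; split; lra.
rewrite {}qp in pq; exists p => i; apply/cvgrPdist_le => e e_gt0.
have [t0 _ px] := clp e setT e_gt0 filterT.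
suff le_e t : (t0 <= t)%N -> forall j, `|p j - x t j| <= e.
  by exists t0 => // t /= /le_e.
elim: t => [|t IHt]; first by rewrite leqn0 => /eqP <-.
rewrite leq_eqVlt => /predU1P[<-//|/IHt].
exact: (midrange_step_dist pq (xS t)).
Qed.

(** * Persistence of visibility *)

Lemma leftmostP (R : realType) (n : nat) (V : R) (p : 'I_n.+1 -> R) (i : 'I_n.+1) :
  0 <= V -> leftmost V p i \in neighborhood V p i /\
  forall j, j \in neighborhood V p i -> p (leftmost V p i) <= p j.
Proof.
move=> V_ge0; rewrite /leftmost; case: arg_minP => //.
by rewrite inE subrr normr0.
Qed.

Lemma rightmostP (R : realType) (n : nat) (V : R) (p : 'I_n.+1 -> R) (i : 'I_n.+1) :
  0 <= V -> rightmost V p i \in neighborhood V p i /\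
  forall j, j \in neighborhood V p i -> p j <= p (rightmost V p i).
Proof.
move=> V_ge0; rewrite /rightmost; case: arg_maxP => //.
by rewrite inE subrr normr0.
Qed.

Lemma visible_step (R : realType) (n : nat) (V : R) (F : {set 'I_n.+1})
  (p q : 'I_n.+1 -> R) (i j : 'I_n.+1) :
  midrange_step (neighborhood V p) F p q -> `|p i - p j| <= V ->
  `|q i - q j| <= V.
Proof.
move=> pq; wlog le_ij : i j / p i <= p j => [WL|].
  have [|/ltW] := leP (p i) (p j); first exact: WL.
  by move=> le_ji; rewrite distrC [in X in _ -> X]distrC; exact: WL.
move=> vij; have V_ge0 : 0 <= V by apply: le_trans vij.
have vE k l : (l \in neighborhood V p k) = (p k - V <= p l <= p k + V).
  by rewrite inE distrC ler_distl.
have /andP[? ?] : p j - V <= p i <= p j + V by rewrite -ler_distl.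
(* Robot [i] sees both itself and [j], so its left end lies in [[p i - V, p i]] and its right end in
   [[p j, p i + V]]; symmetrically for [j]. *)
have /andP[qi1 qi2] : (p i + p j - V) / 2 <= q i <= p i + V / 2.
  move: (pq i); case: ifP => _ => [->|[a [b [+ + ab ->]]]]; first by apply/andP; split; lra.
  rewrite !vE => /andP[? ?] /andP[? ?].
  have /ab/andP[? ?] : i \in neighborhood V p i by rewrite vE; apply/andP; split; lra.
  have /ab/andP[? ?] : j \in neighborhood V p i by rewrite vE; apply/andP; split; lra.
  by apply/andP; split; lra.
have /andP[qj1 qj2] : p j - V / 2 <= q j <= (p i + p j + V) / 2.
  move: (pq j); case: ifP => _ => [->|[a [b [+ + ab ->]]]]; first by apply/andP; split; lra.
  rewrite !vE => /andP[? ?] /andP[? ?].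
  have /ab/andP[? ?] : j \in neighborhood V p j by rewrite vE; apply/andP; split; lra.
  have /ab/andP[? ?] : i \in neighborhood V p j by rewrite vE; apply/andP; split; lra.
  by apply/andP; split; lra.
by rewrite ler_distl; apply/andP; split; lra.
Qed.

Lemma neighborhood_eventually_constant (R : realType) (n : nat) (V : R)
  (F : {set 'I_n.+1}) (x : nat -> 'I_n.+1 -> R) :
  (forall t, midrange_step (neighborhood V (x t)) F (x t) (x t.+1)) ->
  exists t0, forall t, neighborhood V (x (t + t0)%N) = neighborhood V (x t0).
Proof.
move=> xS.
have vis_mono i j t : `|x t i - x t j| <= V -> forall s, (t <= s)%N -> `|x s i - x s j| <= V.
  move=> vt; elim=> [|s IHs]; first by rewrite leqn0 => /eqP <-.
  rewrite leq_eqVlt => /predU1P[<-//|/IHs]; exact: visible_step.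
(* There are finitely many pairs, so one time lies past the first sighting of every pair that ever
   becomes visible. *)
have : \forall t0 \near \oo, forall i j s, `|x s i - x s j| <= V -> `|x t0 i - x t0 j| <= V.
  apply: filter_forall => i; apply: filter_forall => j.
  have [[t vt]|nv] := pselect (exists t, `|x t i - x t j| <= V).
    by exists t => // s /= ts _ _; exact: vis_mono ts.
  by apply: nearW => t s vs; case: nv; exists s.
move=> [t0 _ /(_ t0 (leqnn _)) vt0]; exists t0 => t.
apply/funext => i; apply/setP => j; rewrite !inE; apply/idP/idP => [/vt0//|vij].
exact: vis_mono vij _ (leq_addl _ _).
Qed.

Theorem theorem18 (R : realType) (n : nat) (V : R) (V_gt0 : 0 < V)
  (x : nat -> 'I_n.+1 -> R) (L : R) (L_gt0 : 0 < L)
  (faulty_x0 : forall t : nat, x t ord0 = 0)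
  (faulty_xn : forall t : nat, x t ord_max = L)
  (nonfaulty : forall (i : 'I_n.+1), i != ord0 -> i != ord_max ->
    forall t : nat,
    x t.+1 i = (x t (leftmost V (x t) i) + x t (rightmost V (x t) i)) / 2) :
  (forall i : 'I_n.+1, `|x t.+1 i - x t i| @[t --> \oo] --> (0 : R)) /\
  (exists p : 'I_n.+1 -> R,
     forall i : 'I_n.+1, x t i @[t --> \oo] --> p i).
Proof.
pose F : {set 'I_n.+1} := [set ord0; ord_max]%SET.
have xS t : midrange_step (neighborhood V (x t)) F (x t) (x t.+1).
  move=> i; case: ifPn; rewrite !inE.
    by case/orP => /eqP ->; rewrite ?faulty_x0 ?faulty_xn.
  rewrite negb_or => /andP[i0 imax].
  have [lN lmin] := @leftmostP R n V (x t) i (ltW V_gt0).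
  have [rN rmax] := @rightmostP R n V (x t) i (ltW V_gt0).
  exists (leftmost V (x t) i), (rightmost V (x t) i).
  by split => // [j jN|]; [rewrite lmin// rmax | exact: nonfaulty].
pose B := \sum_i `|x 0%N i|.
have xB t i : `|x t i| <= B.
  elim: t i => [i|t IHt]; last exact: (midrange_step_bounded (xS t)).
  by rewrite /B (bigD1 i)//= lerDl sumr_ge0.
have [t0 Nt0] := neighborhood_eventually_constant xS.
(* Time is shifted by [t0] so that a single neighborhood map governs all steps. *)
have [||i|p xp] := @midrange_cvg R _ (neighborhood V (x t0)) F (fun t => x (t + t0)%N) B.
- by move=> i; rewrite inE subrr normr0 ltW.
- by move=> t; rewrite -(Nt0 t); exact: xS.
- by move=> ?; exact: xB.
have {}xp i : x t i @[t --> \oo] --> p i.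
  by rewrite -(cvg_shiftn t0); exact: xp.
split; last by exists p.
move=> i; rewrite -(normr0 R) -(subrr (p i)).
apply: cvg_norm; apply: cvgB; last exact: xp.
by rewrite (cvg_shiftS (fun t => x t i)).
Qed.
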